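(* Let $c\in(0,1)$, $b=\frac{1+c}{2}$ and $a\in\mathbb{R}$. Let $J$ be a solution of $$\frac{c}{2}J''(t)=\bigl[-b+c\,\Theta(t)\bigr]\,t\,J'(t)+J(t)-\Theta(t)+\frac{c^2}{4}J'(t)^2,\qquad J(-\infty)=1,\quad J(+\infty)=0,$$ and let $p_1$ be any solution of $$\frac{c}{2}p_1''(t)=\bigl(a-c\,\Theta(t)\bigr)p_1(t)+\bigl(b-c\,\Theta(t)\bigr)\,t\,p_1'(t)-\frac{c^2}{2}\bigl(p_1'(t)J'(t)+p_1(t)J''(t)\bigr)$$ with $p_1(t)\sim |t|^{\theta}$ as $t\to-\infty$ and $p_1(t)\sim t^{-\alpha}$ as $t\to+\infty$ (up to nonzero multiplicative constants), where $\theta=\frac{c-a}{b-c}$ and $\alpha=\frac{a}{b}$. Put $f=\Theta+\frac{c}{2}J''$, $g=1-f$, and $$K=\int_{\mathbb{R}}p_1\,f\,g\,dt,\qquad N=\int_{\mathbb{R}}p_1\,f^2g\,dt,\qquad D=\int_{\mathbb{R}}p_1\,(f')^2\,dt .$$ Then $$c\,D=2c\,N+(b-a-c)\,K .$$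
   Context: $\Theta:\mathbb{R}\setminus\{0\}\to\{0,1\}$ denotes the indicator of the negative half-line: $\Theta(t)=1$ for $t<0$ and $\Theta(t)=0$ for $t>0$. A solution $J$ of the nonlinear equation is a real function in $C^1(\mathbb{R})$, twice continuously differentiable on each open half-line $(-\infty,0)$ and $(0,\infty)$ (hence $C^\infty$ there), satisfying the equation for all $t\neq0$ and the stated limits at $\pm\infty$. A solution $p_1$ of the linear equation is a real function in $C^1(\mathbb{R})$, twice continuously differentiable on each open half-line, satisfying the equation for all $t\ne 0$. The asymptotic relation ''$p_1(t)\sim h(t)$ up to a nonzero constant'' means $p_1(t)/h(t)$ tends to a finite nonzero constant. $f$, $g$ and $f'$ are considered for $t\neq 0$ (the single point $t=0$ is irrelevant for the integrals). *)

(* Defs.v *)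
From HB Require Import structures.
From mathcomp Require Import all_boot all_order all_algebra.
From mathcomp Require Import all_classical all_reals all_analysis.

Set Implicit Arguments.
Unset Strict Implicit.
Unset Printing Implicit Defensive.

Import Order.TTheory GRing.Theory Num.Theory.
Import numFieldNormedType.Exports.

Local Open Scope classical_set_scope.
Local Open Scope ring_scope.

(* Only the values at t <> 0 are meaningful; the value 0 at t = 0 is a
   convention that no equation below uses, all of them being imposed for
   t <> 0. *)
Definition Theta (R : realType) (t : R) : R := if t < 0 then 1 else 0.

(* The derivative [derive1 u] is a total operator, so differentiability has to be
   required explicitly. *)
Definition C1_piecewise_C2 (R : realType) (u : R -> R) : Prop :=
  [/\ forall t : R, derivable u t 1,
      continuous (derive1 u),
      forall t : R, t != 0 -> derivable (derive1 u) t 1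
    & forall t : R, t != 0 -> {for t, continuous (derive1n 2 u)}].

Definition nonlinear_solution (R : realType) (c b : R) (J : R -> R) : Prop :=
  [/\ C1_piecewise_C2 J,
      forall t : R, t != 0 ->
        c / 2 * derive1n 2 J t =
          (- b + c * Theta t) * t * derive1 J t + J t - Theta t
          + c ^+ 2 / 4 * derive1 J t ^+ 2,
      J t @[t --> -oo] --> (1 : R)
    & J t @[t --> +oo] --> (0 : R)].

Definition linear_solution (R : realType) (c b a : R) (J p1 : R -> R) : Prop :=
  C1_piecewise_C2 p1 /\
  (forall t : R, t != 0 ->
     c / 2 * derive1n 2 p1 t =
       (a - c * Theta t) * p1 t + (b - c * Theta t) * t * derive1 p1 t
       - c ^+ 2 / 2 * (derive1 p1 t * derive1 J t + p1 t * derive1n 2 J t)).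

(* [p ~ h] along the filter [F], up to a nonzero multiplicative constant. *)
Definition asymp_up_to_const (R : realType) (F : set_system R)
    (p h : R -> R) : Prop :=
  exists2 C : R, C != 0 & p t / h t @[t --> F] --> C.

(* At t = 0 the second derivative of J need not exist and [front_f c J 0] is an
   unspecified value; likewise for the derivative of [front_f c J].  This does
   not affect integrals with respect to Lebesgue measure. *)
Definition front_f (R : realType) (c : R) (J : R -> R) (t : R) : R :=
  Theta t + c / 2 * derive1n 2 J t.

Definition front_g (R : realType) (c : R) (J : R -> R) (t : R) : R :=
  1 - front_f c J t.

Definition K_integrand (R : realType) (c : R) (J p1 : R -> R) (t : R) : R :=
  p1 t * front_f c J t * front_g c J t.

Definition N_integrand (R : realType) (c : R) (J p1 : R -> R) (t : R) : R :=
  p1 t * front_f c J t ^+ 2 * front_g c J t.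

Definition D_integrand (R : realType) (c : R) (J p1 : R -> R) (t : R) : R :=
  p1 t * derive1 (front_f c J) t ^+ 2.

(* Main.v *)
Require Import Defs.
From HB Require Import structures.
From mathcomp Require Import all_boot all_order all_algebra.
From mathcomp Require Import all_classical all_reals all_analysis.
From mathcomp Require Import measurable_realfun ring lra.

(* For t <> 0 the equation for J turns into f'' = (2/c)(c^2/2 J' - m) f' - 2 f g
   with m(t) = (b - c Theta(t)) t, and f, f' extend continuously to 0.  The
   linear equation is L p1 = 0, and the formal adjoint of L sends h = f g to
   c h (2 f - 1) - c f'^2 + (b - a) h.  Hence p1 (c h (2 f - 1) - c f'^2 + (b - a) h)
   is the derivative of the concomitant
     B = (c/2) (p1 h' - p1' h) + (m - c^2/2 J') p1 h,
   and the identity says that its integral vanishes, i.e. that B tends to 0 at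
   both ends.
   Decay: on each half-line y = J - Theta solves nu y'' = - be t y' + y + ka y'^2
   in |t|, with y -> 0; the barrier A e^(-t) bounds y, then y', so f g and f'
   decay faster than any power while p1 grows at most polynomially.  No
   asymptotics of p1' are assumed, but it is polynomially bounded at some point
   of every unit interval by the mean value theorem, and B varies little on
   such intervals. *)

Set Implicit Arguments.
Unset Strict Implicit.
Unset Printing Implicit Defensive.

Import Order.TTheory GRing.Theory Num.Theory.
Import numFieldNormedType.Exports.

Local Open Scope classical_set_scope.
Local Open Scope ring_scope.

(** * Derivatives of functions written pointwise, and the mean value theorem *)

Lemma is_derive_fun_cst {R : realType} (k x : R) :
  is_derive x 1 (fun=> k : R) 0.
Proof. exact: is_derive_cst. Qed.

Lemma is_derive_fun_id {R : realType} (x : R) : is_derive x 1 (fun t : R => t) 1.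
Proof. exact: is_derive_id. Qed.

Lemma is_derive_funN {R : realType} (f : R -> R) (x df : R) :
  is_derive x 1 f df -> is_derive x 1 (fun t => - f t) (- df).
Proof. by move=> ?; exact: is_deriveN. Qed.

(** With an explicit [fun t => ...], a compound derivative can be assembled as one nested term and
    its value adjusted by [is_derive_eq]. *)
Lemma is_derive_funD {R : realType} (f g : R -> R) (x df dg : R) :
  is_derive x 1 f df -> is_derive x 1 g dg ->
  is_derive x 1 (fun t => f t + g t) (df + dg).
Proof. by move=> ? ?; exact: is_deriveD. Qed.

Lemma is_derive_funM {R : realType} (f g : R -> R) (x df dg : R) :
  is_derive x 1 f df -> is_derive x 1 g dg ->
  is_derive x 1 (fun t => f t * g t) (f x * dg + g x * df).
Proof. by move=> ? ?; exact: is_deriveM. Qed.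

Lemma is_derive_opp_arg {R : realType} (f : R -> R) (x df : R) :
  is_derive (- x) 1 f df -> is_derive x 1 (fun t => f (- t)) (- df).
Proof.
move=> dfx; rewrite -mulrN1.
have dN : is_derive x 1 (fun t : R => - t) (-1) by exact: is_deriveNid.
exact: (@is_derive1_comp _ f (fun t : R => - t) x df (-1) dfx dN).
Qed.

Lemma is_derive_expRN {R : realType} (x : R) :
  is_derive x 1 (fun t : R => expR (- t)) (- expR (- x)).
Proof. exact: is_derive_opp_arg (is_derive_expR (- x)). Qed.

Lemma is_derive_continuous {R : realType} (f : R -> R) (x df : R) :
  is_derive x 1 f df -> {for x, continuous f}.
Proof.
by case=> /derivable1_diffP dfx _; exact: differentiable_continuous.
Qed.

(** The difference quotient is eventually within [d] of its limit [d], hence positive, for [h] of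
    either sign. *)
Lemma is_derive_quotient_gt0 {R : realType} (f : R -> R) (x d : R) :
  is_derive x 1 f d -> 0 < d ->
  exists2 e : R, 0 < e &
    forall h, h != 0 -> `|h| < e -> 0 < h^-1 * (f (x + h) - f x).
Proof.
move=> dfx d0.
have dfx1 := @ex_derive _ _ _ _ _ _ _ dfx.
have : h^-1 *: (f (h *: (1:R) + x) - f x) @[h --> 0^'] --> d.
  by rewrite -(@derive_val _ _ _ _ _ _ _ dfx); exact: dfx1.
move=> /cvgrPdist_lt/(_ _ d0).
move=> /nbhs_ballP[e /= e0 He]; exists e => // h h0 he.
have := He h; rewrite /ball /= sub0r normrN => /(_ he h0).
rewrite /GRing.scale /= mulr1 (addrC h x).
by rewrite ltr_norml => /andP[_]; lra.
Qed.

Lemma MVT_le {R : realType} (f df : R -> R) (a b : R) : a < b ->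
  (forall x, a <= x <= b -> is_derive x 1 f (df x)) ->
  exists2 x, a < x < b & f b - f a = df x * (b - a).
Proof.
move=> ab dfx; have [//|||x xab E] := @MVT R f df a b.
- by move=> x; rewrite in_itv/= => /andP[ax xb]; apply: dfx; rewrite !ltW.
- apply: derivable_within_continuous => x; rewrite in_itv/= => /dfx H.
  exact: (@ex_derive _ _ _ _ _ _ _ H).
- by exists x => //; rewrite in_itv/= in xab.
Qed.

(** * Comparison principles of first and second order *)

(** First contact argument: at the first point where [w] reaches 0 it arrives from negative values,
    which a negative derivative forbids. *)
Lemma trapped_lt0 {R : realType} (w dw : R -> R) (s u : R) : s <= u ->
  (forall x, s <= x <= u -> is_derive x 1 w (dw x)) ->
  w s < 0 ->
  (forall x, s <= x <= u -> w x = 0 -> dw x < 0) ->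
  w u < 0.
Proof.
move=> su dwx ws tr; rewrite ltNge; apply/negP => wu.
pose S := [set x | s <= x <= u /\ 0 <= w x].
have Su : S u by rewrite /S/= su lexx.
have hS : has_inf S by split; [exists u|exists s => x [/andP[]]].
pose x0 := inf S.
have sx0 : s <= x0 by apply: lb_le_inf; [exists u|move=> x [/andP[]]].
have x0u : x0 <= u by apply: ge_inf => //; case: hS.
have x0I : s <= x0 <= u by rewrite sx0.
have dx0 := dwx _ x0I.
have /cvgrPdist_lt cw : {for x0, continuous w} by exact: is_derive_continuous dx0.
have below x : s <= x -> x < x0 -> w x < 0.
  move=> sx xx0; rewrite ltNge; apply/negP => wx.
  have : x0 <= x.
    apply: ge_inf; first by case: hS.
    by rewrite /S/= sx wx; split=> //; apply: ltW; apply: lt_le_trans x0u.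
  by rewrite leNgt xx0.
have wx0 : w x0 = 0.
  (* By continuity, [0 < w x0] would contradict negativity to the left of [x0], and [w x0 < 0] would
     contradict that points of [S] come arbitrarily close to [x0]. *)
  apply/eqP; rewrite eq_le; apply/andP; split; rewrite leNgt; apply/negP => wx0.
    have sx0' : s < x0.
      by rewrite lt_neqAle sx0 andbT; apply/eqP => E; move: ws; rewrite E; lra.
    have /nbhs_ballP[e /= e0 He] := cw _ wx0.
    pose d := Num.min (e / 2) (x0 - s).
    have d0 : 0 < d by rewrite lt_min; apply/andP; split; lra.
    have de : d <= e / 2 by rewrite ge_min lexx.
    have dsx : d <= x0 - s by rewrite ge_min lexx orbT.
    have /He : ball x0 e (x0 - d).
      by rewrite /ball/= opprB addrC subrK gtr0_norm//; lra.
    have := @below (x0 - d) ltac:(lra) ltac:(lra).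
    by rewrite ltr_norml => ? /andP[]; lra.
  have wx0' : 0 < - w x0 by lra.
  have /nbhs_ballP[e /= e0 He] := cw _ wx0'.
  have [x Sx xx0] := inf_adherent e0 hS.
  have x0x : x0 <= x by apply: ge_inf => //; case: hS.
  have /He : ball x0 e x.
    by rewrite /ball/= distrC ger0_norm; rewrite /x0 in x0x *; lra.
  by rewrite ltr_norml => /andP[]; case: Sx; lra.
have sx0' : s < x0.
  by rewrite lt_neqAle sx0 andbT; apply/eqP => E; move: ws; rewrite E; lra.
have dN0 : 0 < - dw x0 by have := tr _ x0I wx0; lra.
have [e e0 He] := is_derive_quotient_gt0 (is_derive_funN dx0) dN0.
pose d := Num.min (e / 2) (x0 - s).
have d0 : 0 < d by rewrite lt_min; apply/andP; split; lra.
have de : d <= e / 2 by rewrite ge_min lexx.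
have dsx : d <= x0 - s by rewrite ge_min lexx orbT.
(* The increment [- d] gives [0 < w (x0 - d)], against [below]. *)
have := He (- d) ltac:(by rewrite oppr_eq0 gt_eqF) ltac:(by rewrite normrN gtr0_norm//; lra).
have := @below (x0 - d) ltac:(lra) ltac:(lra).
rewrite wx0 oppr0 subr0 invrN mulrNN => wn.
by rewrite pmulr_rgt0 ?invr_gt0//; lra.
Qed.

(* At an interior positive maximum [dw] would vanish while increasing. *)
Lemma no_positive_max {R : realType} (w dw ddw : R -> R) (s u t : R) :
  s < t < u ->
  (forall x, s <= x <= u -> is_derive x 1 w (dw x)) ->
  (forall x, s <= x <= u -> is_derive x 1 dw (ddw x)) ->
  w s <= 0 -> w u < w t ->
  (forall x, s < x < u -> 0 < w x -> dw x = 0 -> 0 < ddw x) ->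
  w t <= 0.
Proof.
move=> /andP[st tu] d1 d2 ws wu H; rewrite leNgt; apply/negP => wt.
have su : s <= u by lra.
have [|x xsu xmax] := @EVT_max R w s u su.
  apply: derivable_within_continuous => x; rewrite in_itv/= => /d1 Hd.
  exact: (@ex_derive _ _ _ _ _ _ _ Hd).
rewrite in_itv/= in xsu.
have wx : w t <= w x by apply: xmax; rewrite in_itv/= !ltW.
have sx : s < x.
  have /andP[sx _] := xsu; rewrite lt_neqAle sx andbT.
  by apply/eqP => E; move: wx; rewrite -E; lra.
have xu : x < u.
  have /andP[_ xu] := xsu; rewrite lt_neqAle xu andbT.
  by apply/eqP => E; move: wx; rewrite E; lra.
have sxu : s < x < u by rewrite sx.
have dw0 : dw x = 0.
  have D1 := d1 _ xsu.
  have [|||_ <-] := @derive1_at_max R w s u x su.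
  - move=> z; rewrite in_itv/= => /andP[sz zu].
    have D := d1 z ltac:(by rewrite !ltW).
    exact: (@ex_derive _ _ _ _ _ _ _ D).
  - by rewrite in_itv/=.
  - by move=> z; rewrite in_itv/= => /andP[sz zu]; apply: xmax; rewrite in_itv/= !ltW.
  - by rewrite (@derive_val _ _ _ _ _ _ _ D1).
(* Since [dw x = 0] and [0 < ddw x], [dw] is positive just to the right of [x], so [w] exceeds its
   maximum there. *)
have [e e0 He] := is_derive_quotient_gt0 (d2 _ xsu) (H _ sxu ltac:(lra) dw0).
pose d := Num.min (e / 2) (u - x).
have d0 : 0 < d by rewrite lt_min; apply/andP; split; lra.
have de : d <= e / 2 by rewrite ge_min lexx.
have dsx : d <= u - x by rewrite ge_min lexx orbT.
have [||y /andP[y1 y2]] := @MVT_le R w dw x (x + d); first lra.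
  by move=> z /andP[? ?]; apply: d1; apply/andP; split; lra.
have := He (y - x) ltac:(by rewrite gt_eqF//; lra) ltac:(by rewrite gtr0_norm; lra).
rewrite dw0 subr0 addrCA subrr addr0 pmulr_rgt0; last by rewrite invr_gt0; lra.
move=> dy E.
have : 0 < dw y * (x + d - x) by apply: mulr_gt0 => //; lra.
have : w (x + d) <= w x by apply: xmax; rewrite in_itv/=; apply/andP; split; lra.
by lra.
Qed.

(** * Exponential decay for the half-line equation *)

Lemma cvg0_pinfty_bound {R : realType} (y : R -> R) (e : R) :
  y t @[t --> +oo] --> (0 : R) -> 0 < e ->
  exists M : R, forall t, M <= t -> `|y t| <= e.
Proof.
move=> /cvgrPdist_le cy e0; have [M [_ HM]] := cy _ e0.
exists (M + 1) => t Mt; have := HM t ltac:(lra).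
by rewrite /= sub0r normrN.
Qed.

(* Barrier: for large [t] the function [A * expR (- t)] is a strict
   supersolution wherever it touches [y] with equal slope. *)
Lemma tail_upper_bound {R : realType} (nu be ka : R) (y dy ddy : R -> R) :
  0 < nu -> 0 < be ->
  (forall t : R, 0 < t -> is_derive t 1 y (dy t)) ->
  (forall t : R, 0 < t -> is_derive t 1 dy (ddy t)) ->
  (forall t, 0 < t ->
    nu * ddy t = - be * t * dy t + y t + ka * dy t ^+ 2) ->
  y t @[t --> +oo] --> (0 : R) ->
  exists2 A : R, 0 < A &
    exists M : R, forall t, M <= t -> y t <= A * expR (- t).
Proof.
move=> nu0 be0 d1 d2 ode y0.
have [M1 HM1] := cvg0_pinfty_bound y0 ltr01.
(* Beyond [s], [y] is at most 1 in absolute value and the damping [be * t] dominates the other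
   coefficients. *)
pose s := Num.max M1 (Num.max 1 ((nu + `|ka| + 1) / be)).
have sM1 : M1 <= s by rewrite le_max lexx.
have s1 : 1 <= s by rewrite !le_max lexx orbT.
have sb : nu + `|ka| + 1 <= be * s.
  by rewrite (mulrC be) -ler_pdivrMr// !le_max lexx !orbT.
(* This [A] makes the barrier equal to 1 at [s], so that [w s <= 0], and at most 1 afterwards. *)
pose A := expR s; have A0 : 0 < A by exact: expR_gt0.
exists A => //; exists (s + 1) => t st.
pose w x := y x + - (A * expR (- x)).
pose dw x := dy x + (A * expR (- x)).
pose ddw x := ddy x + - (A * expR (- x)).
have dex (x : R) : is_derive x 1 (fun x => A * expR (- x)) (- (A * expR (- x))).
  apply: is_derive_eq (is_derive_funM (is_derive_fun_cst A x) (is_derive_expRN x)) _.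
  by ring.
have dw1 (x : R) : 0 < x -> is_derive x 1 w (dw x).
  move=> x0; apply: is_derive_eq (is_derive_funD (d1 x x0) (is_derive_funN (dex x))) _.
  by rewrite /dw opprK.
have dw2 (x : R) : 0 < x -> is_derive x 1 dw (ddw x).
  by move=> x0; exact: is_derive_funD (d2 x x0) (dex x).
rewrite -subr_le0 -/(w t) leNgt; apply/negP => wt.
(* If [w t] were positive, the decay of [y] would give a later [u] with [w u < w t], hence an
   interior positive maximum. *)
have [M2 HM2] := cvg0_pinfty_bound y0 (e := w t / 2) ltac:(lra).
pose u := Num.max M2 (t + 1).
have uM2 : M2 <= u by rewrite le_max lexx.
have ut : t + 1 <= u by rewrite le_max lexx orbT.
suff : w t <= 0 by lra.
apply: (@no_positive_max R w dw ddw s u t).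
- by apply/andP; split; lra.
- by move=> x /andP[? ?]; apply: dw1; lra.
- by move=> x /andP[? ?]; apply: dw2; lra.
- rewrite /w /A expRxMexpNx_1; have := HM1 s sM1.
  by rewrite ler_norml => /andP[_]; lra.
- have := HM2 u uM2; rewrite ler_norml => /andP[_ yu].
  have : 0 < A * expR (- u) by rewrite mulr_gt0// expR_gt0.
  by rewrite {1}/w; lra.
(* At a critical point [dy x = - p] and [y x > p], so [nu * ddw x] is
   [be * x * p + y x + ka * p ^+ 2 - nu * p], positive by the choice of [s]. *)
move=> x /andP[sx _] wx dwx.
have x0 : 0 < x by lra.
have E := ode x x0.
rewrite /ddw -(pmulr_rgt0 _ nu0).
rewrite /w in wx; rewrite /dw in dwx.
set p := A * expR (- x) in wx dwx *.
have p0 : 0 < p by rewrite mulr_gt0// expR_gt0.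
have p1 : p <= 1.
  by rewrite /p /A -expRD expR_le1; lra.
have dyx : dy x = - p by lra.
rewrite mulrDr E dyx sqrrN.
have k1 : - `|ka| <= ka by have := ler_norm (- ka); rewrite normrN; lra.
have h1 : p * (nu + `|ka| + 1) <= p * (be * x).
  rewrite ler_pM2l//; apply: le_trans sb _; rewrite ler_pM2l//; lra.
have h2 : - (`|ka| * p) <= ka * p ^+ 2.
  have : - `|ka| * p ^+ 2 <= ka * p ^+ 2 by rewrite ler_pM2r// exprn_gt0.
  have : `|ka| * p ^+ 2 <= `|ka| * p.
    by apply: ler_wpM2l; rewrite // expr2 ler_piMr// ltW.
  lra.
nra.
Qed.

(* A point of small slope exists by the mean value theorem, and beyond it the
   damping [- be * t * dy t] makes the region [dy t < B * expR (- t)] forward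
   invariant. *)
Lemma tail_upper_bound_deriv {R : realType} (nu be ka A M : R)
    (y dy ddy : R -> R) :
  0 < nu -> 0 < be -> 0 < A ->
  (forall t : R, 0 < t -> is_derive t 1 y (dy t)) ->
  (forall t : R, 0 < t -> is_derive t 1 dy (ddy t)) ->
  (forall t, 0 < t ->
    nu * ddy t = - be * t * dy t + y t + ka * dy t ^+ 2) ->
  (forall t, M <= t -> `|y t| <= A * expR (- t)) ->
  exists2 B : R, 0 < B &
    exists N : R, forall t, N <= t -> dy t <= B * expR (- t).
Proof.
move=> nu0 be0 A0 d1 d2 ode yA.
have e0 : 0 < expR (1 : R) by exact: expR_gt0.
have e1 : 1 <= expR (1 : R) by have := expR_ge1Dx (1 : R); lra.
(* The mean slope over [[s, s + 1]] is at most [2 * A * expR (- s)], and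
   [expR (- s) <= expR 1 * expR (- r)]; the extra [A] makes the inequality at [r] strict. *)
pose B := 2 * A * expR 1 + A.
have AB : A <= B by have := mulr_gt0 A0 e0; rewrite /B; lra.
have B0 : 0 < B by lra.
pose s := Num.max M (Num.max 1 ((nu + `|ka| * B + 2) / be)).
have sM : M <= s by rewrite le_max lexx.
have s1 : 1 <= s by rewrite !le_max lexx orbT.
have sb : nu + `|ka| * B + 2 <= be * s.
  by rewrite (mulrC be) -ler_pdivrMr// !le_max lexx !orbT.
have [||r /andP[sr rs] Er] := @MVT_le R y dy s (s + 1); first lra.
  by move=> x /andP[? ?]; apply: d1; lra.
have dyr : dy r < B * expR (- r).
  have E1 := yA s sM; have E2 := yA (s + 1) ltac:(lra).
  have q1 : expR (- s) <= expR 1 * expR (- r).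
    by rewrite -expRD ler_expR; lra.
  have q2 : expR (- (s + 1)) <= expR (- s) by rewrite ler_expR; lra.
  have q3 : 0 < A * expR (- r) by rewrite mulr_gt0// expR_gt0.
  have q4 : A * expR (- s) <= A * (expR 1 * expR (- r)) by rewrite ler_pM2l.
  have q5 : A * expR (- (s + 1)) <= A * expR (- s) by rewrite ler_pM2l.
  move: E1 E2; rewrite !ler_norml => /andP[? ?] /andP[? ?].
  rewrite /B mulrDl; lra.
exists B => //; exists (s + 1) => t st; apply: ltW.
rewrite -subr_lt0.
pose w x := dy x + - (B * expR (- x)).
pose dw x := ddy x + (B * expR (- x)).
apply: (@trapped_lt0 R w dw r t); first lra.
- move=> x /andP[rx _].
  have dex : is_derive x 1 (fun x => B * expR (- x)) (- (B * expR (- x))).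
    apply: is_derive_eq (is_derive_funM (is_derive_fun_cst B x) (is_derive_expRN x)) _.
    by ring.
  apply: is_derive_eq (is_derive_funD (d2 x _) (is_derive_funN dex)) _; first lra.
  by rewrite /dw opprK.
- by rewrite /w; lra.
(* At contact [dy x = B * q]; the damping is at least [B * q * (nu + |ka| * B + 2)] in size, while
   the remaining terms total at most [B * q * (nu + |ka| * B + 1)]. *)
move=> x /andP[rx _] wx.
have x0 : 0 < x by lra.
have E := ode x x0.
have yx := yA x ltac:(lra).
rewrite /dw -(pmulr_rlt0 _ nu0).
rewrite /w in wx.
set q := expR (- x) in wx yx *.
have q0 : 0 < q by exact: expR_gt0.
have q1 : q <= 1 by rewrite /q expR_le1; lra.
have p0 : 0 < B * q by exact: mulr_gt0.
have dyx : dy x = B * q by lra.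
rewrite mulrDr E dyx.
have h1 : B * q * (nu + `|ka| * B + 2) <= B * q * (be * x).
  rewrite ler_pM2l//; apply: le_trans sb _; rewrite ler_pM2l//; lra.
have h2 : ka * (B * q) ^+ 2 <= B * q * (`|ka| * B).
  apply: (@le_trans _ _ (`|ka| * (B * q) ^+ 2)).
    by rewrite ler_pM2r ?exprn_gt0// ler_norm.
  rewrite (_ : _ * _ = `|ka| * B * (B * q) * q); last by ring.
  rewrite (_ : B * q * _ = `|ka| * B * (B * q)); last by ring.
  by rewrite ler_piMr// !mulr_ge0// ltW.
have h3 : A * q <= B * q by rewrite ler_pM2r.
move: yx; rewrite ler_norml => /andP[_ yx].
lra.
Qed.

(** The equation is preserved by [y] to [- y] together with [ka] to [- ka], so the one-sided bounds
    applied to both signs become two-sided. *)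
Lemma tail_decay {R : realType} (nu be ka : R) (y dy ddy : R -> R) :
  0 < nu -> 0 < be ->
  (forall t : R, 0 < t -> is_derive t 1 y (dy t)) ->
  (forall t : R, 0 < t -> is_derive t 1 dy (ddy t)) ->
  (forall t, 0 < t ->
    nu * ddy t = - be * t * dy t + y t + ka * dy t ^+ 2) ->
  y t @[t --> +oo] --> (0 : R) ->
  exists A M : R, forall t, M <= t ->
    `|y t| <= A * expR (- t) /\ `|dy t| <= A * expR (- t).
Proof.
move=> nu0 be0 d1 d2 ode y0.
pose y' t := - y t; pose dy' t := - dy t; pose ddy' t := - ddy t.
have d1' (t : R) : 0 < t -> is_derive t 1 y' (dy' t).
  by move=> /d1; exact: is_derive_funN.
have d2' (t : R) : 0 < t -> is_derive t 1 dy' (ddy' t).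
  by move=> /d2; exact: is_derive_funN.
have ode' t : 0 < t ->
    nu * ddy' t = - be * t * dy' t + y' t + - ka * dy' t ^+ 2.
  by move=> /ode; rewrite /ddy' /dy' /y' sqrrN mulrN => ->; ring.
have y0' : y' t @[t --> +oo] --> (0 : R) by rewrite -oppr0; exact: cvgN.
have [A1 A10 [M1 H1]] := tail_upper_bound nu0 be0 d1 d2 ode y0.
have [A2 A20 [M2 H2]] := tail_upper_bound nu0 be0 d1' d2' ode' y0'.
have A0 : 0 < A1 + A2 by lra.
pose M := Num.max M1 M2.
have yA t : M <= t -> `|y t| <= (A1 + A2) * expR (- t).
  rewrite ge_max => /andP[/H1 h1 /H2 h2]; rewrite ler_norml.
  have e0 : 0 < expR (- t) by exact: expR_gt0.
  have := mulr_gt0 A10 e0; have := mulr_gt0 A20 e0.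
  by rewrite /y' in h2; move=> ? ?; apply/andP; split; lra.
have yA' t : M <= t -> `|y' t| <= (A1 + A2) * expR (- t).
  by rewrite /y' normrN; exact: yA.
have [B1 B10 [N1 K1]] := tail_upper_bound_deriv nu0 be0 A0 d1 d2 ode yA.
have [B2 B20 [N2 K2]] := tail_upper_bound_deriv nu0 be0 A0 d1' d2' ode' yA'.
exists (A1 + A2 + B1 + B2), (Num.max M (Num.max N1 N2)) => t.
rewrite !ge_max -!andbA => /and4P[tM1 tM2 /K1 k1 /K2 k2].
have /yA h : M <= t by rewrite ge_max tM1.
have e0 : 0 < expR (- t) by exact: expR_gt0.
have := mulr_gt0 A10 e0; have := mulr_gt0 A20 e0.
have := mulr_gt0 B10 e0; have := mulr_gt0 B20 e0.
rewrite /dy' in k2; move=> ? ? ? ?; split; first lra.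
by rewrite ler_norml; apply/andP; split; lra.
Qed.

(** * Polynomial growth and rapid decay *)

(** Only large [|t|] is constrained, so jumps and local behaviour do not matter; [1 <= M] makes
    powers of [|t|] monotone in the exponent. *)
Definition tempered {R : realType} (u : R -> R) : Prop :=
  exists k : nat, exists C M : R,
    [/\ 0 <= C, 1 <= M & forall t, M <= `|t| -> `|u t| <= C * `|t| ^+ k].

Definition rapid {R : realType} (u : R -> R) : Prop :=
  forall k : nat, exists C M : R,
    1 <= M /\ forall t, M <= `|t| -> `|u t| * `|t| ^+ k <= C.

Section growth.
Context {R : realType}.
Implicit Types u v : R -> R.

Lemma tempered_cst (a : R) : tempered (fun=> a).
Proof.
by exists 0, `|a|, 1; split=> // t _; rewrite expr0 mulr1.
Qed.

Lemma tempered_id : tempered (fun t : R => t).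
Proof. by exists 1, 1, 1; split=> // t _; rewrite expr1 mul1r. Qed.

Lemma tempered_bounded u (C : R) : (forall t, `|u t| <= C) -> tempered u.
Proof.
move=> uC; exists 0, C, 1; split=> [|//|t _]; last by rewrite expr0 mulr1.
exact: le_trans (uC 0).
Qed.

Lemma temperedD u v : tempered u -> tempered v ->
  tempered (fun t => u t + v t).
Proof.
move=> [k [C [M [C0 M1 uC]]]] [l [D [N [D0 N1 vD]]]].
exists (k + l)%N, (C + D), (Num.max M N); split; first exact: addr_ge0.
  by rewrite le_max M1.
move=> t; rewrite ge_max => /andP[Mt Nt].
have t1 : 1 <= `|t| by exact: le_trans Mt.
apply: le_trans (ler_normD _ _) _; rewrite mulrDl lerD//.
  by apply: le_trans (uC _ Mt) _; rewrite ler_wpM2l// ler_weXn2l// leq_addr.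
by apply: le_trans (vD _ Nt) _; rewrite ler_wpM2l// ler_weXn2l// leq_addl.
Qed.

Lemma temperedM u v : tempered u -> tempered v ->
  tempered (fun t => u t * v t).
Proof.
move=> [k [C [M [C0 M1 uC]]]] [l [D [N [D0 N1 vD]]]].
exists (k + l)%N, (C * D), (Num.max M N); split; first exact: mulr_ge0.
  by rewrite le_max M1.
move=> t; rewrite ge_max => /andP[Mt Nt].
rewrite normrM exprD mulrACA ler_pM//; [exact: uC|exact: vD].
Qed.

Lemma temperedN u : tempered u -> tempered (fun t => - u t).
Proof.
by move=> [k [C [M [C0 M1 H]]]]; exists k, C, M; split=> // t /H; rewrite normrN.
Qed.

Lemma rapidN u : rapid u -> rapid (fun t => - u t).
Proof.
by move=> ru k; have [C [M [M1 H]]] := ru k; exists C, M; split=> // t /H; rewrite normrN.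
Qed.

Lemma rapid_tempered u : rapid u -> tempered u.
Proof.
move=> /(_ 0%N)[C [M [M1 uC]]]; exists 0%N, `|C|, M; split=> // t /uC.
by rewrite expr0 !mulr1 => /le_trans; apply; exact: ler_norm.
Qed.

Lemma rapidD u v : rapid u -> rapid v -> rapid (fun t => u t + v t).
Proof.
move=> ru rv k; have [C [M [M1 uC]]] := ru k; have [D [N [N1 vD]]] := rv k.
exists (C + D), (Num.max M N); split; first by rewrite le_max M1.
move=> t; rewrite ge_max => /andP[Mt Nt].
apply: le_trans (_ : (`|u t| + `|v t|) * `|t| ^+ k <= _).
  by rewrite ler_wpM2r// ler_normD.
by rewrite mulrDl lerD//; [exact: uC|exact: vD].
Qed.

Lemma rapidMtempered u v : rapid u -> tempered v ->
  rapid (fun t => u t * v t).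
Proof.
move=> ru [l [D [N [D0 N1 vD]]]] k; have [C [M [M1 uC]]] := ru (l + k)%N.
exists (C * D), (Num.max M N); split; first by rewrite le_max M1.
move=> t; rewrite ge_max => /andP[Mt Nt].
rewrite normrM; apply: le_trans (_ : `|u t| * (D * `|t| ^+ l) * `|t| ^+ k <= _).
  by rewrite ler_wpM2r// ler_wpM2l// vD.
have -> : `|u t| * (D * `|t| ^+ l) * `|t| ^+ k = `|u t| * `|t| ^+ (l + k) * D.
  by rewrite exprD; ring.
by rewrite ler_wpM2r// uC.
Qed.

Lemma temperedMrapid u v : tempered u -> rapid v ->
  rapid (fun t => u t * v t).
Proof.
move=> tu rv; rewrite (_ : (fun t => _) = (fun t => v t * u t)).
  exact: rapidMtempered.
by apply/funext => t; rewrite mulrC.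
Qed.

Lemma eq_rapid u v : u =1 v -> rapid u -> rapid v.
Proof. by move=> /funext ->. Qed.

Lemma rapid_expRN u (A M : R) :
  (forall t, M <= `|t| -> `|u t| <= A * expR (- `|t|)) -> rapid u.
Proof.
move=> uA k; exists (`|A| * k.+1`!%:R), (Num.max 1 M).
split; first by rewrite le_max lexx.
move=> t; rewrite ge_max => /andP[t1 /uA ut].
have e0 : 0 < expR (- `|t|) by exact: expR_gt0.
have f0 : 0 < k.+1`!%:R :> R by rewrite ltr0n fact_gt0.
have ut' : `|u t| <= `|A| * expR (- `|t|).
  by apply: le_trans ut _; rewrite ler_pM2r// ler_norm.
apply: le_trans (ler_wpM2r (exprn_ge0 k (normr_ge0 t)) ut') _.
rewrite -mulrA ler_wpM2l//.
rewrite expRN mulrC ler_pdivrMr ?expR_gt0//.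
(* The exponential dominates one term of its series, of degree [k.+1]; this is the origin of the
   factorial. *)
have := expR_ge1Dxn k (normr_ge0 t) => h.
have {h} h : `|t| ^+ k.+1 / k.+1`!%:R <= expR `|t| by lra.
rewrite ler_pdivrMr// mulrC in h.
by apply: le_trans h; rewrite ler_weXn2l.
Qed.

(** The product of [|u t|] and [1 + t ^+ 2] is bounded on a compact interval by continuity, and
    outside by rapid decay with exponents 0 and 2. This supplies an integrable majorant. *)
Lemma continuous_rapid_bound u : continuous u -> rapid u ->
  exists C : R, forall t, `|u t| <= C * (1 + t ^+ 2)^-1.
Proof.
move=> cu ru.
have [C0 [M0 [M01 u0]]] := ru 0%N; have [C2 [M2 [M21 u2]]] := ru 2%N.
pose M := Num.max M0 M2.
pose w t := `|u t| * (1 + t ^+ 2).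
have cw : continuous w.
  move=> x; apply: cvgM; first exact: cvg_norm (cu x).
  by apply: cvgD; [exact: cvg_cst|apply: cvgM; exact: cvg_id].
have M1 : 1 <= M by rewrite le_max M01.
have [x _ wx] := @EVT_max R w (- M) M ltac:(lra) (continuous_subspaceT cw).
exists (w x + `|C0| + `|C2|) => t.
have t0 : 0 < 1 + t ^+ 2 by have := sqr_ge0 t; lra.
rewrite ler_pdivlMr// -/(w t).
have wx0 : 0 <= w x by rewrite mulr_ge0// addr_ge0// sqr_ge0.
have [tM|tM] := leP `|t| M.
  have : w t <= w x by apply: wx; rewrite in_itv/= -ler_norml.
  by move/le_trans; apply; rewrite -addrA lerDl addr_ge0.
have /andP[tM0 tM2] : (M0 <= `|t|) && (M2 <= `|t|).
  by rewrite -ge_max -/M; exact: ltW.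
have h0 := u0 _ tM0; have h2 := u2 _ tM2.
rewrite expr0 mulr1 in h0; rewrite real_normK ?num_real// in h2.
rewrite /w mulrDr mulr1 -addrA; apply: le_trans (lerD h0 h2) _.
by rewrite -lerBlDl; have := ler_norm C0; have := ler_norm C2; move: wx0; rewrite /w; lra.
Qed.

(** Near each end the quotient is within 1 of its limit [C], so [|u t|] is at most [1 + |C|] times a
    real power of [|t|]; one natural exponent above both real ones serves the two ends. *)
Lemma tempered_asymp u (a1 a2 : R) :
  asymp_up_to_const -oo u (fun t : R => `|t| `^ a1) ->
  asymp_up_to_const +oo u (fun t : R => t `^ a2) -> tempered u.
Proof.
move=> [C1 _ /cvgrPdist_le/(_ 1 ltr01)[M1 [_ H1]]].
move=> [C2 _ /cvgrPdist_le/(_ 1 ltr01)[M2 [_ H2]]].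
have [k ak] : exists k : nat, `|a1| + `|a2| <= k%:R.
  by exists (Num.bound (`|a1| + `|a2|)); rewrite ltW// archi_boundP ?addr_ge0.
have a1k : a1 <= k%:R by have := ler_norm a1; have := normr_ge0 a2; lra.
have a2k : a2 <= k%:R by have := ler_norm a2; have := normr_ge0 a1; lra.
have main (t C a : R) : 1 <= `|t| -> a <= k%:R -> `|C - u t / `|t| `^ a| <= 1 ->
    `|u t| <= (1 + `|C|) * `|t| ^+ k.
  move=> t1 ak' h.
  have h0 : 0 < `|t| `^ a by rewrite powR_gt0//; lra.
  have h1 : `|t| `^ a <= `|t| ^+ k by rewrite -powR_mulrn// ler_powR.
  have {}h : `|u t / `|t| `^ a| <= 1 + `|C|.
    have -> : u t / `|t| `^ a = C - (C - u t / `|t| `^ a) by ring.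
    by apply: le_trans (ler_normB _ _) _; lra.
  rewrite normrM normfV (gtr0_norm h0) ler_pdivrMr// in h.
  by apply: le_trans h _; rewrite ler_wpM2l// addr_ge0.
exists k, (1 + `|C1| + `|C2|), (1 + `|M1| + `|M2|); split.
- by rewrite !addr_ge0.
- by rewrite -addrA lerDl addr_ge0.
move=> t Mt.
have t1 : 1 <= `|t| by have := normr_ge0 M1; have := normr_ge0 M2; lra.
have tk : 0 <= `|t| ^+ k by exact: exprn_ge0.
have [t0|t0] := leP 0 t.
  have := @main t C2 a2 t1 a2k; rewrite {1 2}(ger0_norm t0).
  have M2t : M2 < t.
    have := normr_ge0 M1; have := ler_norm M2; have := ger0_norm t0; lra.
  rewrite (ger0_norm t0) => /(_ (H2 _ M2t))/le_trans; apply.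
  by rewrite ler_wpM2r ?exprn_ge0//; have := normr_ge0 C1; lra.
have M1t : t < M1.
  have := normr_ge0 M2; have := ler_norm (- M1); rewrite normrN.
  have := ltr0_norm t0; lra.
apply: le_trans (main t C1 a1 t1 a1k (H1 _ M1t)) _.
by rewrite ler_wpM2r//; have := normr_ge0 C2; lra.
Qed.

(* [dp] is only controlled at the mean value points of unit intervals; the
   bound at the other points comes from integrating [dB]. *)
Lemma boundary_term_decay (B dB h r p dp : R -> R) (e : R) :
  `|e| = 1 ->
  (forall t : R, t != 0 -> is_derive t 1 B (dB t)) ->
  (forall t : R, is_derive t 1 p (dp t)) ->
  (forall t, B t = h t * dp t + r t) ->
  rapid dB -> rapid h -> rapid r -> tempered p ->
  exists D M : R, forall t, M <= t -> `|B (e * t)| * t <= D.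
Proof.
move=> e1 dBt dpt BE rdB rh rr [k [C [M1 [C0 M11 pC]]]].
have [C2 [M2 [M21 hC]]] := rh k.+1.
have [C3 [M3 [M31 rC]]] := rr 1%N.
have [C4 [M4 [M41 dBC]]] := rdB 1%N.
(* The sign [e] treats both ends of the line at once, with [t] positive. *)
have ne t : 0 <= t -> `|e * t| = t by move=> t0; rewrite normrM e1 mul1r ger0_norm.
have de (f df : R -> R) t : is_derive (e * t) 1 f (df (e * t)) ->
    is_derive t 1 (fun s => f (e * s)) (df (e * t) * e).
  move=> D.
  have De : is_derive t 1 (fun s : R => e * s) e.
    apply: is_derive_eq (is_derive_funM (is_derive_fun_cst e t) (is_derive_fun_id t)) _.
    by rewrite mulr1 mulr0 addr0.
  exact: (@is_derive1_comp _ f (fun s : R => e * s) t _ e D De).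
exists (C2 * (2 * C * 2 ^+ k) + C3 + C4), (Num.max (Num.max M1 M2) (Num.max M3 M4)).
move=> t; rewrite !ge_max -!andbA => /and4P[t1 t2 t3 t4].
have t0 : 1 <= t by lra.
have dpe (z : R) : t <= z <= t + 1 ->
    is_derive z 1 (fun s => p (e * s)) (dp (e * z) * e).
  by move=> _; exact: (de p dp).
have tt1 : t < t + 1 by lra.
(* At [x] the slope of [p] is an increment of [p] over a unit interval; as [t] and [t + 1] are at
   most [2 * x], it is bounded by a multiple of [x ^+ k]. *)
have [x /andP[tx xt] Ep] := MVT_le tt1 dpe.
have dBe (z : R) : t <= z <= x ->
    is_derive z 1 (fun s => B (e * s)) (dB (e * z) * e).
  move=> /andP[? ?]; apply: (de B dB); apply: dBt.
  by rewrite -normr_eq0 ne ?gt_eqF//; lra.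
(* A second mean value point carries the bound on [B] from [x] back to [t], at distance less than
   1. *)
have [y /andP[ty yx] EB] := MVT_le tx dBe.
have p1 := pC (e * t); have p2 := pC (e * (t + 1)).
have h1 := hC (e * x); have r1 := rC (e * x); have dB1 := dBC (e * y).
rewrite ne in p1; last lra.
rewrite ne in p2; last lra.
rewrite !ne in h1; last lra.
rewrite !ne in r1; last lra.
rewrite !ne in dB1; last lra.
have {}p1 := p1 t1; have {}p2 := p2 ltac:(lra).
have {}h1 := h1 ltac:(lra); have {}r1 := r1 ltac:(lra).
have {}dB1 := dB1 ltac:(lra).
rewrite expr1 in r1; rewrite expr1 in dB1.
have q1 : t ^+ k <= (2 * x) ^+ k by rewrite lerXn2r// ?nnegrE; lra.
have q2 : (t + 1) ^+ k <= (2 * x) ^+ k by rewrite lerXn2r// ?nnegrE; lra.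
have dpx : `|dp (e * x)| <= 2 * C * 2 ^+ k * x ^+ k.
  have -> : `|dp (e * x)| = `|p (e * (t + 1)) - p (e * t)|.
    by rewrite Ep addrAC subrr add0r mulr1 normrM e1 mulr1.
  apply: le_trans (ler_normB _ _) _.
  apply: le_trans (lerD p2 p1) _.
  rewrite exprMn in q1 q2.
  have := ler_wpM2l C0 q1; have := ler_wpM2l C0 q2; lra.
have Bx : `|B (e * x)| * x <= C2 * (2 * C * 2 ^+ k) + C3.
  rewrite BE; apply: le_trans (_ : (`|h (e * x)| * `|dp (e * x)| + `|r (e * x)|) * x <= _).
    rewrite ler_wpM2r//; first lra.
    by rewrite -normrM; exact: ler_normD.
  rewrite mulrDl lerD//.
  apply: le_trans (_ : `|h (e * x)| * (2 * C * 2 ^+ k * x ^+ k) * x <= _).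
    by rewrite ler_wpM2r ?ler_wpM2l//; lra.
  rewrite (_ : _ * x = `|h (e * x)| * x ^+ k.+1 * (2 * C * 2 ^+ k)); last first.
    by rewrite exprS; ring.
  by rewrite ler_wpM2r// !mulr_ge0// exprn_ge0.
have -> : B (e * t) = B (e * x) - dB (e * y) * e * (x - t) by rewrite -EB; ring.
apply: le_trans (_ : (`|B (e * x)| + `|dB (e * y)|) * t <= _).
  rewrite ler_wpM2r//; first lra.
  apply: le_trans (ler_normB _ _) _; rewrite lerD2l !normrM e1 mulr1.
  by rewrite ler_piMr// ger0_norm; lra.
rewrite mulrDl lerD//.
  by apply: le_trans Bx; rewrite ler_wpM2l//; lra.
by apply: le_trans dB1; rewrite ler_wpM2l//; lra.
Qed.

End growth.

(** * Integrals over the whole line *)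

Section integration.
Context {R : realType}.
Notation mu := (@lebesgue_measure R).

Lemma integrableT_oneDsqrV :
  mu.-integrable setT (EFin \o (fun t : R => (1 + t ^+ 2)^-1)).
Proof.
have mf : measurable_fun setT (fun t : R => (1 + t ^+ 2)^-1).
  by apply: continuous_measurable_fun; exact: continuous_oneDsqrV.
have f0 (t : R) : 0 <= (1 + t ^+ 2)^-1.
  by rewrite invr_ge0 addr_ge0// sqr_ge0.
apply/integrableP; split; first exact/measurable_EFinP.
under eq_integral do rewrite /= ger0_norm//.
rewrite ge0_symfun_integralT//; last 2 first.
- exact: continuous_oneDsqrV.
- by move=> x /=; rewrite sqrrN.
by rewrite -set_itvcy integral0y_oneDsqr -EFinM ltry.
Qed.

Lemma integrableT_rapid (u : R -> R) : continuous u -> rapid u ->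
  mu.-integrable setT (EFin \o u).
Proof.
move=> cu ru; have [C uC] := continuous_rapid_bound cu ru.
have C0 : 0 <= C.
  by have := uC 0; rewrite expr0n addr0 invr1 mulr1; exact: le_trans.
apply: (@le_integrable _ _ _ mu setT _ _ (EFin \o (fun t => C * (1 + t ^+ 2)^-1))) => //.
- by apply/measurable_EFinP; exact: continuous_measurable_fun.
- move=> t _; rewrite /= lee_fin (ger0_norm (_ : 0 <= C * _)); first exact: uC.
  by rewrite mulr_ge0// invr_ge0 addr_ge0// sqr_ge0.
- exact: integrableZl integrableT_oneDsqrV.
Qed.

(** The integrands built from [front_f] are unspecified at 0. That point is a null set, and
    measurability is checked separately on it and on its complement. *)
Lemma eq_off0_integral (u v : R -> R) : continuous u -> rapid u ->
  (forall t : R, t != 0 -> v t = u t) ->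
  mu.-integrable setT (EFin \o v) /\
  \int[mu]_(t in setT) v t = \int[mu]_(t in setT) u t.
Proof.
move=> cu ru vu.
have mu_ : measurable_fun setT u by exact: continuous_measurable_fun.
have mD : measurable ([set~ 0] : set R) by apply: measurableC; exact: measurable_set1.
have mv0 : measurable_fun ([set~ 0] : set R) v.
  apply: (@eq_measurable_fun _ _ _ _ _ u) => [t|]; last exact: measurable_funTS.
  by rewrite inE/= => /eqP t0; rewrite vu.
have mv : measurable_fun setT v.
  rewrite -(setUv [set (0 : R)]); apply/measurable_funU => //.
  by split=> //; exact: measurable_fun_set1.
have aeq : ae_eq mu setT (EFin \o v) (EFin \o u).
  exists ([set 0] : set R); split; [exact: measurable_set1|exact: lebesgue_measure_set1|].
  move=> t /= /not_implyP[_ H]; apply/eqP/negP => /negP t0.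
  by apply: H; rewrite vu.
have iu := integrableT_rapid cu ru.
split.
  apply/integrableP; split; first exact/measurable_EFinP.
  move: iu => /integrableP[_]; apply: le_lt_trans.
  rewrite (@ae_eq_integral _ _ _ mu setT (abse \o (EFin \o u)))//.
  - by apply: measurableT_comp => //; exact/measurable_EFinP.
  - by apply: measurableT_comp => //; exact/measurable_EFinP.
  - by apply: filterS aeq => t h D; have /= [->] := h D.
rewrite /Rintegral; congr fine.
by apply: ae_eq_integral => //; exact/measurable_EFinP.
Qed.

(** Differentiability is asked only inside the interval, so that 0 can be an endpoint. *)
Lemma Rintegral_derivative (B G : R -> R) (a b : R) : a < b ->
  continuous B -> continuous G ->
  (forall t : R, a < t < b -> is_derive t 1 B (G t)) ->
  \int[mu]_(t in `[a, b]) G t = B b - B a.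
Proof.
move=> ab cB cG dB.
rewrite /Rintegral (@continuous_FTC2 _ G B a b ab) //=.
- exact: continuous_subspaceT.
- split.
  + by move=> t; rewrite in_itv/= => /dB D; exact: (@ex_derive _ _ _ _ _ _ _ D).
  + exact: cvg_at_right_filter (cB a).
  + exact: cvg_at_left_filter (cB b).
- move=> t; rewrite in_itv/= => /dB D.
  by rewrite derive1E (@derive_val _ _ _ _ _ _ _ D).
Qed.

(** Over growing symmetric intervals the integral of [G] is a difference of boundary values of order
    [1 / n], while dominated convergence gives the integral over the line. *)
Lemma Rintegral_total_derivative (B G : R -> R) (D M : R) :
  continuous B -> continuous G -> rapid G ->
  (forall t : R, t != 0 -> is_derive t 1 B (G t)) ->
  (forall t, M <= t -> `|B t| * t <= D) ->
  (forall t, M <= t -> `|B (- t)| * t <= D) ->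
  \int[mu]_(t in setT) G t = 0.
Proof.
move=> cB cG rG dB Bp Bm.
have iG := integrableT_rapid cG rG.
have iS A : measurable A -> mu.-integrable A (EFin \o G).
  by move=> mA; apply: integrableS iG.
pose I n : set R := `[- n.+1%:R, n.+1%:R]%classic.
have mI n : measurable (I n) by exact: measurable_itv.
have IE n : \int[mu]_(t in I n) G t = B n.+1%:R - B (- n.+1%:R).
  have n0 : 0 < n.+1%:R :> R by rewrite ltr0n.
  (* The interval is cut at 0, where [B] need not be differentiable; [n.+1] keeps both pieces
     nondegenerate. *)
  have := @Rintegral_itvB R G (BLeft (- n.+1%:R)) (BRight n.+1%:R) 0.
  rewrite !bnd_simp oppr_le0 => /(_ (iS _ (mI n))).
  move=> /(_ (ltW n0) (ltW n0)).
  rewrite Rintegral_itv_obnd_cbnd; last first.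
    exact: iS.
  have dl (t : R) : - n.+1%:R < t < 0 -> is_derive t 1 B (G t).
    by move=> /andP[_ t0]; apply: dB; rewrite lt_eqF.
  have dr (t : R) : 0 < t < n.+1%:R -> is_derive t 1 B (G t).
    by move=> /andP[t0 _]; apply: dB; rewrite gt_eqF.
  have nn0 : - n.+1%:R < 0 :> R by rewrite oppr_lt0.
  rewrite (Rintegral_derivative nn0 cB cG dl) (Rintegral_derivative n0 cB cG dr).
  by rewrite /I; lra.
have [|||||_ _] := @dominated_convergence _ _ R mu setT measurableT
  (fun n => (EFin \o G) \_ (I n)) (EFin \o G) (abse \o (EFin \o G)).
- move=> n; apply/(measurable_restrict _ (mI n) measurableT).
  by apply: measurable_funTS; exact: measurable_int iG.
- exact: measurable_int iG.
- apply: aeW => t _; apply: cvg_near_cst.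
  near=> n; rewrite patchE mem_set// /I/= in_itv/= -ler_norml.
  near: n; exists (Num.bound `|t|) => // n /= tn.
  apply: ltW; apply: lt_le_trans (archi_boundP (normr_ge0 t)) _.
  by rewrite ler_nat leqW.
- exact: integrable_abse.
- apply: aeW => t n _; rewrite patchE; case: ifP => //= _.
  by rewrite normr0 lee_fin.
move=> cI.
have cI0 : (\int[mu]_(t in I n) G t) @[n --> \oo] --> (0 : R).
  apply/cvgrPdist_le => e e0.
  near=> n.
  rewrite sub0r normrN IE.
  have n0 : 0 < n.+1%:R :> R by rewrite ltr0n.
  have nM : M <= n.+1%:R
    by apply: le_trans (_ : n%:R <= _); [near: n; exact: nbhs_infty_ger|rewrite ler_nat].
  have nD : 2 * D / e <= n.+1%:R
    by apply: le_trans (_ : n%:R <= _); [near: n; exact: nbhs_infty_ger|rewrite ler_nat].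
  have b1 := Bp _ nM; have b2 := Bm _ nM.
  apply: le_trans (ler_normB _ _) _.
  rewrite -(ler_pM2r n0) mulrDl; rewrite ler_pdivrMr// in nD.
  by lra.
have : (\int[mu]_(t in I n) G t)%:E @[n --> \oo] -->
    (\int[mu]_(t in setT) (G t)%:E)%E.
  apply: cvg_trans cI; apply: near_eq_cvg; apply: nearW => n /=.
  rewrite -integral_mkcond /Rintegral fineK//.
  apply: integrable_fin_num => //.
    exact: (mI n).
  exact: (iS _ (mI n)).
move=> cIT; rewrite {1}/Rintegral.
have cE : (\int[mu]_(t in I n) G t)%:E @[n --> \oo] --> (0 : R)%:E.
  by apply: cvg_EFin; [exact: nearW|exact: cI0].
by rewrite (cvg_unique (@ereal_hausdorff R) cIT cE).
Unshelve. all: by end_near. Qed.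

End integration.

(** * Pointwise continuity rules and conversions for [derive1] *)

Section continuity.
Context {R : realType}.
Implicit Types f g : R -> R.

Lemma continuous_funD f g : continuous f -> continuous g ->
  continuous (fun t => f t + g t).
Proof. by move=> cf cg t; apply: cvgD; [exact: cf|exact: cg]. Qed.

Lemma continuous_funN f : continuous f -> continuous (fun t => - f t).
Proof. by move=> cf t; apply: cvgN; exact: cf. Qed.

Lemma continuous_funM f g : continuous f -> continuous g ->
  continuous (fun t => f t * g t).
Proof. by move=> cf cg t; apply: cvgM; [exact: cf|exact: cg]. Qed.

Lemma continuous_fun_cst (k : R) : continuous (fun _ : R => k).
Proof. by move=> t; exact: cvg_cst. Qed.

Lemma derivable_is_derive1 f (t : R) :
  derivable f t 1 -> is_derive t 1 f (derive1 f t).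
Proof. by move=> df; rewrite derive1E; exact: DeriveDef. Qed.

Lemma is_derive_derive1 f (t d : R) : is_derive t 1 f d -> derive1 f t = d.
Proof. by move=> H; rewrite derive1E (@derive_val _ _ _ _ _ _ _ H). Qed.

End continuity.

(** * The step function *)

Section Theta.
Context {R : realType}.

Lemma Theta_idem (t : R) : Theta t * Theta t = Theta t.
Proof. by rewrite /Theta; case: ifP; rewrite ?mulr1 ?mulr0. Qed.

Lemma near_Theta (t : R) : t != 0 -> \forall s \near t, Theta s = Theta t.
Proof.
rewrite /Theta neq_lt => /orP[t0|t0].
  by rewrite t0; near do rewrite ifT//; exact: lt_nbhsl.
rewrite [t < 0]ltNge ltW//=; near do rewrite ifN -?leNgt//.
by apply: filterS (lt_nbhsr t0) => s /ltW.
Unshelve. all: by end_near. Qed.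

Lemma tempered_Theta : tempered (@Theta R).
Proof.
apply: (@tempered_bounded _ _ 1) => t; rewrite /Theta.
by case: ifP; rewrite ?normr1 ?normr0.
Qed.

(** The factor [t] removes the jump of [Theta]; hence the product is kept together in [m] and [F1]
    below. *)
Lemma Theta_mul_id (t : R) : Theta t * t = Num.min t 0.
Proof. by rewrite /Theta minEle; case: ltgtP => [||->]; rewrite ?mul1r ?mul0r. Qed.

Lemma continuous_Theta_mul : continuous (fun t : R => Theta t * t).
Proof.
rewrite (_ : (fun t => _) = (fun t : R => Num.min t 0)).
  by move=> t; apply: continuous_min; [exact: cvg_id|exact: cvg_cst].
by apply/funext => t; rewrite Theta_mul_id.
Qed.

Lemma is_derive_Theta_mul (t : R) : t != 0 ->
  is_derive t 1 (fun s : R => Theta s * s) (Theta t).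
Proof.
move=> t0; apply: (@near_eq_is_derive _ _ _ (fun s => Theta t * s)).
  by apply: filterS (near_Theta t0) => s ->.
apply: is_derive_eq (is_derive_funM (is_derive_fun_cst (Theta t) t) (is_derive_fun_id t)) _.
by rewrite mulr1 mulr0 addr0.
Qed.

End Theta.

(** * Decay of the front at both ends *)

Lemma front_tail_decay {R : realType} (c b : R) (J : R -> R) :
  0 < c -> c < b -> nonlinear_solution c b J ->
  exists A M : R, forall t, M <= `|t| ->
    `|J t - Theta t| <= A * expR (- `|t|) /\
    `|derive1 J t| <= A * expR (- `|t|).
Proof.
move=> c0 cb [[dJ _ dJ1 _] ode Jm Jp].
have d1 (t : R) : is_derive t 1 J (derive1 J t) by exact: derivable_is_derive1.
have d2 (t : R) : t != 0 -> is_derive t 1 (derive1 J) (derive1n 2 J t).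
  by move=> /dJ1 /derivable_is_derive1.
have nu0 : 0 < c / 2 by lra.
have b0 : 0 < b by lra.
have bc0 : 0 < b - c by lra.
have e1 (t : R) : 0 < t ->
    c / 2 * derive1n 2 J t = - b * t * derive1 J t + J t + c ^+ 2 / 4 * derive1 J t ^+ 2.
  by move=> t0; rewrite ode ?gt_eqF// /Theta ltNge ltW//=; ring.
have d2p (t : R) : 0 < t -> is_derive t 1 (derive1 J) (derive1n 2 J t).
  by move=> t0; apply: d2; rewrite gt_eqF.
have [A1 [M1 H1]] := tail_decay nu0 b0 (fun t _ => d1 t) d2p e1 Jp.
(* Reflection turns the left end into the same half-line equation, with damping [b - c] in place of
   [b]; positivity is where [c < b] enters. *)
pose y (t : R) := J (- t) + - 1.
pose dy (t : R) := - derive1 J (- t).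
pose ddy (t : R) := derive1n 2 J (- t).
have dy1 (t : R) : 0 < t -> is_derive t 1 y (dy t).
  move=> _; apply: is_derive_eq
    (is_derive_funD (is_derive_opp_arg (d1 (- t))) (is_derive_fun_cst (- 1) t)) _.
  by rewrite addr0.
have dy2 (t : R) : 0 < t -> is_derive t 1 dy (ddy t).
  move=> t0; have tN0 : - t != 0 by rewrite oppr_eq0 gt_eqF.
  apply: is_derive_eq (is_derive_funN (is_derive_opp_arg (d2 _ tN0))) _.
  by rewrite opprK.
have e2 (t : R) : 0 < t ->
    c / 2 * ddy t = - (b - c) * t * dy t + y t + c ^+ 2 / 4 * dy t ^+ 2.
  move=> t0; rewrite /ddy ode ?oppr_eq0 ?gt_eqF// /Theta oppr_lt0 t0.
  by rewrite /dy /y sqrrN; ring.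
have y0 : y t @[t --> +oo] --> (0 : R).
  rewrite -[X in _ --> X](subrr (1 : R)); apply: cvgD; last exact: cvg_cst.
  by move/cvgNy_compNP : Jm.
have [A2 [M2 H2]] := tail_decay nu0 bc0 dy1 dy2 e2 y0.
exists (`|A1| + `|A2|), (Num.max 1 (Num.max M1 M2)) => t.
rewrite !ge_max => /and3P[t1 tM1 tM2].
have e0 : 0 <= expR (- `|t|) by exact: expR_ge0.
have h1 : A1 * expR (- `|t|) <= (`|A1| + `|A2|) * expR (- `|t|).
  by rewrite ler_wpM2r//; have := ler_norm A1; have := normr_ge0 A2; lra.
have h2 : A2 * expR (- `|t|) <= (`|A1| + `|A2|) * expR (- `|t|).
  by rewrite ler_wpM2r//; have := ler_norm A2; have := normr_ge0 A1; lra.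
have [t0|t0] := ltP t 0.
  have [u1 u2] := H2 _ tM2; rewrite /y /dy in u1 u2.
  rewrite (ltr0_norm t0) !opprK in u1 u2 h2 *; rewrite normrN in u2.
  by rewrite /Theta t0; split; [exact: le_trans u1 h2|exact: le_trans u2 h2].
have [u1 u2] := H1 _ tM1.
rewrite (ger0_norm t0) in u1 u2 h1 *.
by rewrite /Theta ltNge t0/= subr0; split; [exact: le_trans u1 h1|exact: le_trans u2 h1].
Qed.

(** * The concomitant and its derivative *)

Section identity.
Context {R : realType}.
Variables (c a b : R) (J p : R -> R).
Hypotheses (hc : 0 < c < 1) (hb : b = (1 + c) / 2).
Hypotheses (hJ : nonlinear_solution c b J) (hp : linear_solution c b a J p).
Hypothesis tp : tempered p.

Let c0 : 0 < c. Proof. by case/andP: hc. Qed.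
Let cn0 : c != 0. Proof. by rewrite gt_eqF. Qed.

Let J1 : R -> R := derive1 J.
Let J2 : R -> R := derive1n 2 J.
Let p1 : R -> R := derive1 p.
Let p2 : R -> R := derive1n 2 p.

Let dJ (t : R) : is_derive t 1 J (J1 t).
Proof. by apply: derivable_is_derive1; case: hJ => -[]. Qed.

Let dJ1 (t : R) : t != 0 -> is_derive t 1 J1 (J2 t).
Proof. by move=> t0; apply: derivable_is_derive1; case: hJ => -[_ _ /(_ t t0)]. Qed.

Let dp (t : R) : is_derive t 1 p (p1 t).
Proof. by apply: derivable_is_derive1; case: hp => -[]. Qed.

Let dp1 (t : R) : t != 0 -> is_derive t 1 p1 (p2 t).
Proof. by move=> t0; apply: derivable_is_derive1; case: hp => -[_ _ /(_ t t0)]. Qed.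

Let cJ : continuous J. Proof. by move=> t; exact: is_derive_continuous (dJ t). Qed.
Let cp : continuous p. Proof. by move=> t; exact: is_derive_continuous (dp t). Qed.
Let cJ1 : continuous J1. Proof. by case: hJ => -[]. Qed.
Let cp1 : continuous p1. Proof. by case: hp => -[]. Qed.

Let m (t : R) : R := b * t - c * (Theta t * t).

(* The versions of [front_f c J], its derivative and its second derivative in
   which [J''] has been eliminated; the first two are continuous at 0. *)
Let F (t : R) : R := J t - m t * J1 t + c ^+ 2 / 4 * (J1 t * J1 t).
Let F1 (t : R) : R :=
  (1 - b) * J1 t + 2 / c * (b - c) * (Theta t * t)
  + 2 / c * (F t * (c ^+ 2 / 2 * J1 t - m t)).
Let F2 (t : R) : R :=
  2 / c * ((c ^+ 2 / 2 * J1 t - m t) * F1 t - c * (F t * (1 - F t))).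

Let front_fE (t : R) : t != 0 -> front_f c J t = F t.
Proof.
move=> t0; have [_ /(_ t t0) ode _ _] := hJ.
by rewrite /front_f ode /F /m /J1; ring.
Qed.

Let J2E (t : R) : t != 0 -> J2 t = 2 / c * (F t - Theta t).
Proof. by move=> t0; rewrite -front_fE// /front_f -/J2; field. Qed.

Let p2E (t : R) : t != 0 -> p2 t =
  2 / c * ((a - c * Theta t) * p t + m t * p1 t
    - c ^+ 2 / 2 * (p1 t * J1 t + p t * J2 t)).
Proof.
move=> t0; have [_ /(_ t t0) ode] := hp.
apply: (@mulfI _ (c / 2)); first by rewrite mulf_neq0// invr_eq0 pnatr_eq0.
by rewrite ode -/p1 -/J1 -/J2 /m; field.
Qed.

Let dm (t : R) : t != 0 -> is_derive t 1 m (b - c * Theta t).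
Proof.
move=> t0; have dT := is_derive_Theta_mul t0.
apply: is_derive_eq (is_derive_funD
  (is_derive_funM (is_derive_fun_cst b t) (is_derive_fun_id t))
  (is_derive_funN (is_derive_funM (is_derive_fun_cst c t) dT))) _.
by ring.
Qed.

Let dF (t : R) : t != 0 -> is_derive t 1 F (F1 t).
Proof.
move=> t0; apply: is_derive_eq (is_derive_funD
  (is_derive_funD (dJ t) (is_derive_funN (is_derive_funM (dm t0) (dJ1 t0))))
  (is_derive_funM (is_derive_fun_cst _ t)
    (is_derive_funM (dJ1 t0) (dJ1 t0)))) _.
have T2 := Theta_idem t.
rewrite (J2E t0) /F1 /m.
(* The product of [m] with the [Theta] in [J2] creates a square of [Theta], which [field] cannot
   simplify. The terms in [Theta t * J1 t] cancel, which leaves [F1] continuous. *)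
have -> : 2 / c * (b - c) * (Theta t * t) =
    2 / c * b * (Theta t * t) - 2 * (Theta t * Theta t * t).
  by rewrite T2; field.
by field.
Qed.

Let dF1 (t : R) : t != 0 -> is_derive t 1 F1 (F2 t).
Proof.
move=> t0; have dT := is_derive_Theta_mul t0.
apply: is_derive_eq (is_derive_funD
  (is_derive_funD
    (is_derive_funM (is_derive_fun_cst _ t) (dJ1 t0))
    (is_derive_funM (is_derive_fun_cst _ t) dT))
  (is_derive_funM (is_derive_fun_cst _ t) (is_derive_funM (dF t0)
    (is_derive_funD (is_derive_funM (is_derive_fun_cst _ t) (dJ1 t0))
      (is_derive_funN (dm t0)))))) _.
(* Up to the factor [2 / c], the coefficient of [Theta] is [2 * b - 1 - c] and that of [F] is
   [1 - 2 * b]; the value of [b] makes them 0 and [- c]. *)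
by rewrite (J2E t0) /F2 hb; field.
Qed.

Let derive1_front_f (t : R) : t != 0 -> derive1 (front_f c J) t = F1 t.
Proof.
move=> t0; apply: is_derive_derive1; apply: (@near_eq_is_derive _ _ _ F); last exact: dF.
have : \forall s \near t, s != 0.
  move: t0; rewrite neq_lt => /orP[t0|t0].
    by apply: filterS (lt_nbhsl t0) => s s0; rewrite lt_eqF.
  by apply: filterS (lt_nbhsr t0) => s s0; rewrite gt_eqF.
by apply: filterS => s s0; rewrite front_fE.
Qed.

(** The concomitant for [h = F * (1 - F)], with [h' = F1 * (1 - 2 * F)] written out. *)
Let B (t : R) : R :=
  c / 2 * (p t * (F1 t * (1 - 2 * F t)) - p1 t * (F t * (1 - F t)))
  + (m t - c ^+ 2 / 2 * J1 t) * (p t * (F t * (1 - F t))).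

Let Kc (t : R) : R := p t * (F t * (1 - F t)).
Let Nc (t : R) : R := p t * (F t * (F t * (1 - F t))).
Let Dc (t : R) : R := p t * (F1 t * F1 t).

Let G (t : R) : R := 2 * c * Nc t + (b - a - c) * Kc t - c * Dc t.

Let dB (t : R) : t != 0 -> is_derive t 1 B (G t).
Proof.
move=> t0.
have d1F : is_derive t 1 (fun s => 1 - F s) (- F1 t).
  apply: is_derive_eq (is_derive_funD (is_derive_fun_cst 1 t) (is_derive_funN (dF t0))) _.
  by rewrite add0r.
have d2F : is_derive t 1 (fun s => 1 - 2 * F s) (- (2 * F1 t)).
  apply: is_derive_eq (is_derive_funD (is_derive_fun_cst 1 t)
    (is_derive_funN (is_derive_funM (is_derive_fun_cst 2 t) (dF t0)))) _.
  by ring.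
have dh := is_derive_funM (dF t0) d1F.
have dh1 := is_derive_funM (dF1 t0) d2F.
apply: is_derive_eq (is_derive_funD
  (is_derive_funM (is_derive_fun_cst _ t) (is_derive_funD
    (is_derive_funM (dp t) dh1)
    (is_derive_funN (is_derive_funM (dp1 t0) dh))))
  (is_derive_funM
    (is_derive_funD (dm t0)
      (is_derive_funN (is_derive_funM (is_derive_fun_cst _ t) (dJ1 t0))))
    (is_derive_funM (dp t) dh))) _.
(* Once the second derivatives are eliminated, all terms in [p1] and all explicit [Theta] cancel,
   and [F2] absorbs the drift term in [h']. *)
rewrite (p2E t0) (J2E t0) /G /Nc /Kc /Dc /F2.
by field.
Qed.

(** * Continuity and decay of the ingredients *)

Let cm : continuous m.
Proof.
apply: continuous_funD.
  by apply: continuous_funM; [exact: continuous_fun_cst|move=> t; exact: cvg_id].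
apply: continuous_funN; apply: continuous_funM; first exact: continuous_fun_cst.
exact: continuous_Theta_mul.
Qed.

(** The [Theta] case precedes the general product, since [Theta] alone is not continuous. *)
Ltac cont := lazymatch goal with
  | |- forall x, continuous_at x (fun t => Theta _ * _) =>
      exact: continuous_Theta_mul
  | |- forall x, continuous_at x (fun t => _ + _) => apply: continuous_funD; cont
  | |- forall x, continuous_at x (fun t => _ * _) => apply: continuous_funM; cont
  | |- forall x, continuous_at x (fun t => - _) => apply: continuous_funN; cont
  | |- _ => first [assumption | exact: continuous_fun_cst]
  end.

Let cF : continuous F. Proof. by rewrite /F; cont. Qed.
Let cF1 : continuous F1.
Proof. by rewrite /F1; cont. Qed.

Let rapid_J1 : rapid J1.
Proof.
have cb : c < b by rewrite hb; move/andP: hc => [_ ?]; lra.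
have [A [M H]] := front_tail_decay c0 cb hJ.
by apply: (@rapid_expRN _ _ A M) => t /H[].
Qed.

Let rapid_J : rapid (fun t => J t - Theta t).
Proof.
have cb : c < b by rewrite hb; move/andP: hc => [_ ?]; lra.
have [A [M H]] := front_tail_decay c0 cb hJ.
by apply: (@rapid_expRN _ _ A M) => t /H[].
Qed.

Let tempered_m : tempered m.
Proof.
apply: temperedD; first by apply: temperedM; [exact: tempered_cst|exact: tempered_id].
apply: temperedN; apply: temperedM; first exact: tempered_cst.
by apply: temperedM; [exact: tempered_Theta|exact: tempered_id].
Qed.

Let rapid_F : rapid (fun t => F t - Theta t).
Proof.
apply: (@eq_rapid _ (fun t =>
    J t - Theta t + (- (m t * J1 t) + c ^+ 2 / 4 * (J1 t * J1 t)))).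
  by move=> t; rewrite /F; ring.
apply: rapidD => //; apply: rapidD; first by apply: rapidN; exact: temperedMrapid.
apply: temperedMrapid; first exact: tempered_cst.
by apply: rapidMtempered => //; exact: rapid_tempered.
Qed.

Let tempered_F : tempered F.
Proof.
rewrite (_ : F = fun t => F t - Theta t + Theta t).
  by apply: temperedD; [exact: rapid_tempered|exact: tempered_Theta].
by apply/funext => t; rewrite subrK.
Qed.

Let rapid_F1 : rapid F1.
Proof.
(* In the definition of [F1] the terms [Theta t * t] and [F t * m t] grow at [-oo]; grouping around
   [F t - Theta t] exhibits their cancellation. *)
apply: (@eq_rapid _ (fun t => (1 - b + c * Theta t) * J1 t
    + (F t - Theta t) * (2 / c * (c ^+ 2 / 2 * J1 t - m t)))).
  move=> t; rewrite /F1 /m; have T2 := Theta_idem t.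
  have -> : 2 / c * (b - c) * (Theta t * t) =
    2 / c * b * (Theta t * t) - 2 * (Theta t * Theta t * t) by rewrite T2; field.
  by field.
apply: rapidD.
  apply: temperedMrapid => //; apply: temperedD; first exact: tempered_cst.
  by apply: temperedM; [exact: tempered_cst|exact: tempered_Theta].
apply: rapidMtempered => //; apply: temperedM; first exact: tempered_cst.
apply: temperedD; last exact: temperedN.
by apply: temperedM; [exact: tempered_cst|exact: rapid_tempered].
Qed.

Let rapid_h : rapid (fun t => F t * (1 - F t)).
Proof.
(* This factorization rests on [Theta] being idempotent, and its first factor is rapid at both
   ends. *)
apply: (@eq_rapid _ (fun t => (F t - Theta t) * (1 - F t - Theta t))).
  by move=> t; have T2 := Theta_idem t; ring: T2.
apply: rapidMtempered => //; apply: temperedD; last exact/temperedN/tempered_Theta.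
by apply: temperedD; [exact: tempered_cst|exact: temperedN].
Qed.

Let rapid_Kc : rapid Kc. Proof. exact: temperedMrapid. Qed.
Let rapid_Nc : rapid Nc.
Proof. by apply: temperedMrapid => //; exact: temperedMrapid. Qed.
Let rapid_Dc : rapid Dc.
Proof.
apply: temperedMrapid => //; apply: rapidMtempered => //; exact: rapid_tempered.
Qed.
Let rapid_G : rapid G.
Proof.
apply: rapidD; last first.
  by apply: rapidN; apply: temperedMrapid => //; exact: tempered_cst.
by apply: rapidD; apply: temperedMrapid => //; exact: tempered_cst.
Qed.

(** The coefficient of [p1] in [B] is isolated, [p1] being the one factor without a pointwise growth
    bound. *)
Let h0 (t : R) : R := - (c / 2) * (F t * (1 - F t)).
Let r0 (t : R) : R := c / 2 * (p t * (F1 t * (1 - 2 * F t)))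
  + (m t - c ^+ 2 / 2 * J1 t) * Kc t.

Let BE (t : R) : B t = h0 t * p1 t + r0 t.
Proof. by rewrite /B /h0 /r0 /Kc; ring. Qed.

Let rapid_r0 : rapid r0.
Proof.
apply: rapidD.
  apply: temperedMrapid; first exact: tempered_cst.
  apply: temperedMrapid => //; apply: rapidMtempered => //.
  apply: temperedD; first exact: tempered_cst.
  by apply: temperedN; apply: temperedM => //; exact: tempered_cst.
apply: temperedMrapid => //; apply: temperedD => //; apply: temperedN.
by apply: temperedM; [exact: tempered_cst|exact: rapid_tempered].
Qed.

Let cKc : continuous Kc.
Proof. by rewrite /Kc; cont. Qed.
Let cNc : continuous Nc.
Proof. by rewrite /Nc; cont. Qed.
Let cDc : continuous Dc.
Proof. by rewrite /Dc; cont. Qed.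
Let cG : continuous G.
Proof. by rewrite /G; cont. Qed.
Let cB : continuous B.
Proof. by rewrite /B; cont. Qed.

(** * Integration of the concomitant's derivative *)

Notation mu := (@lebesgue_measure R).

Lemma front_identity :
  [/\ mu.-integrable setT (EFin \o K_integrand c J p),
      mu.-integrable setT (EFin \o N_integrand c J p),
      mu.-integrable setT (EFin \o D_integrand c J p)
    & c * \int[mu]_(t in setT) D_integrand c J p t =
      2 * c * \int[mu]_(t in setT) N_integrand c J p t
      + (b - a - c) * \int[mu]_(t in setT) K_integrand c J p t].
Proof.
have KE (t : R) : t != 0 -> K_integrand c J p t = Kc t.
  by move=> t0; rewrite /K_integrand /front_g front_fE// /Kc; ring.
have NE (t : R) : t != 0 -> N_integrand c J p t = Nc t.
  by move=> t0; rewrite /N_integrand /front_g front_fE// /Nc; ring.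
have DE (t : R) : t != 0 -> D_integrand c J p t = Dc t.
  by move=> t0; rewrite /D_integrand derive1_front_f// /Dc; ring.
(* Each integrand is replaced by its continuous version, equal to it off 0. *)
have [iK ->] := eq_off0_integral cKc rapid_Kc KE.
have [iN ->] := eq_off0_integral cNc rapid_Nc NE.
have [iD ->] := eq_off0_integral cDc rapid_Dc DE.
split=> //.
have rh0 : rapid h0 by apply: temperedMrapid => //; exact: tempered_cst.
have [D1 [M1 H1]] := boundary_term_decay (normr1 R) dB dp BE rapid_G rh0 rapid_r0 tp.
have [D2 [M2 H2]] := boundary_term_decay (normrN1 R) dB dp BE rapid_G rh0 rapid_r0 tp.
have G0 : \int[mu]_(t in setT) G t = 0.
  apply: (@Rintegral_total_derivative _ B G (Num.max D1 D2) (Num.max M1 M2)) => //.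
  - move=> t; rewrite ge_max => /andP[/H1 + _]; rewrite mul1r => /le_trans; apply.
    by rewrite le_max lexx.
  - move=> t; rewrite ge_max => /andP[_ /H2]; rewrite mulN1r => /le_trans; apply.
    by rewrite le_max lexx orbT.
have iKc := integrableT_rapid cKc rapid_Kc.
have iNc := integrableT_rapid cNc rapid_Nc.
have iDc := integrableT_rapid cDc rapid_Dc.
have iZ (k : R) (u : R -> R) : continuous u -> rapid u ->
    mu.-integrable setT (EFin \o (fun t => k * u t)).
  move=> cu ru; apply: integrableT_rapid; first by cont.
  by apply: temperedMrapid => //; exact: tempered_cst.
have iS : mu.-integrable setT (EFin \o (fun t => 2 * c * Nc t + (b - a - c) * Kc t)).
  apply: integrableT_rapid; first by cont.
  by apply: rapidD; apply: temperedMrapid => //; exact: tempered_cst.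
(* Linearity of the integral turns the vanishing integral of [G] into the identity. *)
move: G0; rewrite /G RintegralB//; last exact: iZ.
rewrite RintegralD//; [|exact: iZ|exact: iZ].
by rewrite !RintegralZl// => /subr0_eq ->.
Qed.

End identity.

Theorem theorem9 (R : realType) (c a b theta alpha : R) (J p1 : R -> R)
  (hc : 0 < c < 1)
  (hb : b = (1 + c) / 2)
  (htheta : theta = (c - a) / (b - c))
  (halpha : alpha = a / b)
  (hJ : nonlinear_solution c b J)
  (hp1 : linear_solution c b a J p1)
  (hp1_ninfty : asymp_up_to_const -oo p1 (fun t : R => `|t| `^ theta))
  (hp1_pinfty : asymp_up_to_const +oo p1 (fun t : R => t `^ (- alpha))) :
  let mu := @lebesgue_measure R in
  let K := \int[mu]_(t in setT) K_integrand c J p1 t in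
  let N := \int[mu]_(t in setT) N_integrand c J p1 t in
  let D := \int[mu]_(t in setT) D_integrand c J p1 t in
  [/\ mu.-integrable setT (EFin \o K_integrand c J p1),
      mu.-integrable setT (EFin \o N_integrand c J p1),
      mu.-integrable setT (EFin \o D_integrand c J p1)
    & c * D = 2 * c * N + (b - a - c) * K].
Proof.
exact: (front_identity hc hb hJ hp1 (tempered_asymp hp1_ninfty hp1_pinfty)).
Qed.
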